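(* Let $A$ be a Banach algebra, let $B$ be a Banach $A$-bimodule, let $n\ge 2$ be an even integer, let $0\le r\le \frac n2$ be an integer, and let $\phi\in U_{n,r}$. Then $\phi\in Z^{\ell}_{B^{(n)}}(U_{n,r})$ if and only if $b^{(n-1)}\phi\in B^{(n-1)}$ for all $b^{(n-1)}\in B^{(n-1)}$.
   Context: For a Banach space $X$ put $X^{(0)}=X$ and $X^{(k+1)}=(X^{(k)})^*$; $X^{(k)}$ is identified with its canonical image in $X^{(k+2)}$. For a bounded bilinear map $m:X\times Y\to Z$ of normed spaces define $m^*:Z^*\times X\to Y^*$ by $\langle m^*(z',x),y\rangle=\langle z',m(x,y)\rangle$, $m^{**}=(m^* )^*:Y^{**}\times Z^*\to X^*$ and $m^{***}=(m^{**})^*:X^{**}\times Y^{**}\to Z^{**}$. Let $\pi:A\times A\to A$, $\pi_\ell:A\times B\to B$, $\pi_r:B\times A\to B$ be the (bounded) multiplication and module actions. For every even $k\ge 0$, $A^{(k)}$ is a Banach algebra and $B^{(k)}$ is a Banach $A^{(k)}$-bimodule, defined recursively: the multiplication (first Arens product) and the two module actions at level $k+2$ are the extensions $m^{***}$ of those at level $k$. All products are written by juxtaposition. Explicitly, for $k$ even, $a\in A^{(k)}$, $b\in B^{(k)}$, $b'\in B^{(k+1)}$, $a''\in A^{(k+2)}$, $b''\in B^{(k+2)}$: $b'a\in B^{(k+1)}$, $\langle b'a,b\rangle=\langle b',ab\rangle$; $b''b'\in A^{(k+1)}$, $\langle b''b',a\rangle=\langle b'',b'a\rangle$; $\langle a''b'',b'\rangle=\langle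 a'',b''b'\rangle$. The analogous formulas with $B$ replaced by $A$ define the products on the duals of $A$. For $b^{(n-1)}\in B^{(n-1)}$ and $\phi\in A^{(n)}$, $b^{(n-1)}\phi$ is the element of $B^{(n+1)}$ given by $\langle b^{(n-1)}\phi,b^{(n)}\rangle=\langle \phi b^{(n)},b^{(n-1)}\rangle$ for $b^{(n)}\in B^{(n)}$. For integers $p,q\ge0$, at least one even, $A^{(p)}A^{(q)}$ is the linear span of all products $a^{(p)}a^{(q)}$, $a^{(p)}\in A^{(p)}$, $a^{(q)}\in A^{(q)}$ (with respect to the first Arens product; when $p\ge q$ it is a subspace of $A^{(p)}$). For $n$ even and $0\le r\le n/2$, set $U_{n,r}=(A^{(n-r)}A^{(r)})^{(r)}$ if $r$ is even and $U_{n,r}=(A^{(n-r)}A^{(r-1)})^{(r)}$ if $r$ is odd, where the outer superscript $(r)$ denotes the $r$-th dual. By the convention of the paper, $U_{n,r}$ is regarded as a subalgebra of $A^{(n)}$ with the first Arens product, and it acts on $B^{(n)}$ by restriction of the action of $A^{(n)}$. The weak$^*$ topology on $B^{(n)}$ is $\sigma(B^{(n)},B^{(n-1)})$. Define $$Z^{\ell}_{B^{(n)}}(U_{n,r})=\{\phi\in U_{n,r}:\ b^{(n)}\mapsto \phi b^{(n)},\ B^{(n)}\to B^{(n)},\ \text{is weak}^*\text{-to-weak}^*\text{ continuous}\}.$$ *)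

(* Defs.v *)
From HB Require Import structures.
From mathcomp Require Import all_boot all_order all_algebra.
From mathcomp Require Import sesquilinear.
From mathcomp Require Import complex.
From mathcomp Require Import all_classical all_reals all_analysis.

Set Implicit Arguments.
Unset Strict Implicit.
Unset Printing Implicit Defensive.

Import Order.TTheory GRing.Theory Num.Theory.
Import numFieldNormedType.Exports.

Local Open Scope classical_set_scope.
Local Open Scope ring_scope.

(* Banach spaces are taken over the real or the complex numbers. *)
Inductive scalars := RealScalars | ComplexScalars.

Definition scalarField (R : realType) (s : scalars) : numFieldType :=
  match s with
  | RealScalars => (R : numFieldType)
  | ComplexScalars => (R[i] : numFieldType)
  end.

Lemma scalarField_glb (R : realType) (s : scalars) (S : set (scalarField R s)) :
  S !=set0 -> (forall x, S x -> 0 <= x) ->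
  exists g, [/\ 0 <= g, forall x, S x -> g <= x &
    forall h, 0 <= h -> (forall x, S x -> h <= x) -> h <= g].
Proof.
have glbR (T : set R) : T !=set0 -> (forall x, T x -> 0 <= x) ->
  exists g, [/\ 0 <= g, forall x, T x -> g <= x &
    forall h, 0 <= h -> (forall x, T x -> h <= x) -> h <= g].
  move=> T0 Tge0; exists (inf T); split.
  - by apply: lb_le_inf => // x /Tge0.
  - by move=> x Tx; apply: ge_inf => //; exists 0 => y /Tge0.
  - by move=> h _ hT; apply: lb_le_inf => // x /hT.
case: s S => [|] S S0 Sge0 /=; first exact: glbR.
have [||g [g0 gS gP]] := glbR [set x : R | S (x%:C)%C].
- case: S0 => -[a b] Sx; exists a => /=.
  have := Sge0 _ Sx; rewrite lecE /= => /andP[/eqP b0 _].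
  by rewrite b0 in Sx.
- by move=> x /Sge0; rewrite lecE /= => /andP[].
exists (g%:C)%C; split.
- by rewrite lecE /= eqxx.
- move=> [a b] Sx; have := Sge0 _ Sx; rewrite !lecE /= => /andP[/eqP b0 _].
  rewrite b0 in Sx; rewrite b0 eqxx /=; exact: gS.
- move=> [a b]; rewrite !lecE /= => /andP[/eqP b0 a0] hS.
  rewrite -b0 eqxx /=; apply: gP => // x /hS.
  by rewrite lecE /= => /andP[].
Qed.

Section Duality.
Context {R : realType} {s : scalars}.
Local Notation K := (scalarField R s).

Definition op_bound (X Y : normedModType K) (f : X -> Y) (M : K) : Prop :=
  forall x, `|f x| <= M * `|x|.

Section DualSpace.
Variable X : normedModType K.

Definition dual_pred : pred (X -> K^o) :=
  fun f => `[< linear f /\ exists M, op_bound f M >].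

Record dual := MkDual { dual_fun : X -> K^o ; dual_funP : dual_fun \in dual_pred }.

HB.instance Definition _ := [isSub for dual_fun].
HB.instance Definition _ := [Choice of dual by <:].

Lemma dual_submod_closed : submod_closed dual_pred.
Proof.
split.
  apply/asboolP; split; first by move=> a u v; rewrite /= scaler0 addr0.
  by exists 0 => x; rewrite normr0 mul0r.
move=> a f g /asboolP[lf [M fM]] /asboolP[lg [N gN]]; apply/asboolP; split.
  move=> b u v; rewrite !fctE lf lg.
  by rewrite !scalerDr !scalerA (mulrC a b) addrACA.
exists (`|a| * M + N) => x; rewrite !fctE.
rewrite (le_trans (ler_normD _ _))// mulrDl lerD//.
by rewrite normrZ -mulrA ler_wpM2l.
Qed.

HB.instance Definition _ :=
  GRing.isSubmodClosed.Build K (X -> K^o) dual_pred dual_submod_closed.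
HB.instance Definition _ := [SubChoice_isSubLmodule of dual by <:].

Lemma dual_linear (f : dual) : linear (dual_fun f).
Proof. by case: f => f /= /asboolP[]. Qed.

Lemma dual_bounded (f : dual) : exists M, op_bound (dual_fun f) M.
Proof. by case: f => f /= /asboolP[]. Qed.

Definition opnorm (f : dual) : K :=
  get [set M | [/\ 0 <= M, op_bound (dual_fun f) M &
    forall N, 0 <= N -> op_bound (dual_fun f) N -> M <= N]].

Lemma opnormP (f : dual) : [/\ 0 <= opnorm f, op_bound (dual_fun f) (opnorm f) &
  forall N, 0 <= N -> op_bound (dual_fun f) N -> opnorm f <= N].
Proof.
suff : [set M | [/\ 0 <= M, op_bound (dual_fun f) M &
    forall N, 0 <= N -> op_bound (dual_fun f) N -> M <= N]] !=set0.
  by case=> M PM; rewrite /opnorm; case: xgetP => [N -> []//|/(_ M)].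
have [M fM] := dual_bounded f.
have [||g [g0 gS gP]] :=
    @scalarField_glb R s [set N | 0 <= N /\ op_bound (dual_fun f) N].
- exists `|M|; split=> // x; rewrite (le_trans (fM x))//.
  have Mx : 0 <= M * `|x| by exact: le_trans (fM x).
  by rewrite -(ger0_norm Mx) normrM normr_id.
- by move=> x [].
exists g; split => //; last by move=> N N0 fN; exact: gS.
move=> x; have [->|x0] := eqVneq x 0.
  have -> : dual_fun f 0 = 0.
    by have := dual_linear f (-1) 0 0; rewrite scaler0 addr0 scaleN1r addNr.
  by rewrite !normr0 mulr0.
rewrite -ler_pdivrMr ?normr_gt0//; apply: gP; first by rewrite divr_ge0.
by move=> N [N0 fN]; rewrite ler_pdivrMr ?normr_gt0.
Qed.

Lemma opnorm_ge0 f : 0 <= opnorm f. Proof. by have [] := opnormP f. Qed.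

Lemma opnorm_bound f x : `|dual_fun f x| <= opnorm f * `|x|.
Proof. by have [_ + _] := opnormP f; apply. Qed.

Lemma opnorm_le f N : 0 <= N -> op_bound (dual_fun f) N -> opnorm f <= N.
Proof. by have [_ _] := opnormP f; apply. Qed.

Lemma opnormD f g : opnorm (f + g) <= opnorm f + opnorm g.
Proof.
apply: opnorm_le; first by rewrite addr_ge0 ?opnorm_ge0.
move=> x; rewrite (_ : dual_fun _ = dual_fun f + dual_fun g)//.
rewrite fctE (le_trans (ler_normD _ _))// mulrDl.
by rewrite lerD ?opnorm_bound.
Qed.

Lemma opnormZ_le (a : K) f : opnorm (a *: f) <= `|a| * opnorm f.
Proof.
apply: opnorm_le; first by rewrite mulr_ge0 ?opnorm_ge0.
move=> x; rewrite (_ : dual_fun _ = a *: dual_fun f)//.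
by rewrite fctE normrZ -mulrA ler_wpM2l// opnorm_bound.
Qed.

Lemma opnorm_eq0 f : opnorm f = 0 -> f = 0.
Proof.
move=> f0; apply/val_inj/funext => x /=; apply/eqP.
by rewrite -normr_le0 (le_trans (opnorm_bound f x))// f0 mul0r.
Qed.

Lemma opnormZ (a : K) f : opnorm (a *: f) = `|a| * opnorm f.
Proof.
have [->|a0] := eqVneq a 0.
  rewrite normr0 mul0r; apply/eqP; rewrite eq_le opnorm_ge0 andbT.
  by rewrite (le_trans (opnormZ_le _ _))// normr0 mul0r.
apply/eqP; rewrite eq_le opnormZ_le /=.
have := opnormZ_le a^-1 (a *: f); rewrite scalerA mulVf// scale1r normfV.
by rewrite ler_pdivlMl ?normr_gt0.
Qed.

HB.instance Definition _ :=
  Lmodule_isNormed.Build K dual opnormD opnormZ opnorm_eq0.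

End DualSpace.
Arguments dual_pred X _ : clear implicits.

Definition Dual (X : normedModType K) : normedModType K := dual X.

Definition pairing (X : normedModType K) (f : Dual X) : X -> K^o := dual_fun f.

Fixpoint ndual (X : normedModType K) (n : nat) : normedModType K :=
  if n is m.+1 then Dual (ndual X m) else X.

Lemma ndualD (X : normedModType K) (p r : nat) :
  ndual (ndual X p) r = ndual X (r + p).
Proof. by elim: r => [|r IH] //=; rewrite IH. Qed.

(* The identification of $(X^{(p)})^{(r)}$ with $X^{(n)}$ for $n = r + p$. *)
Definition ndual_cast (X : normedModType K) (p r n : nat) (e : (r + p)%N = n) :
    ndual (ndual X p) r -> ndual X n :=
  fun x => eq_rect _ (fun Y : normedModType K => Y) x _
    (etrans (ndualD X p r) (congr1 (ndual X) e)).

Lemma pairing_norm (X : normedModType K) (f : Dual X) x :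
  `|pairing f x| <= `|f| * `|x|.
Proof. exact: opnorm_bound. Qed.

Lemma pairing_linear (X : normedModType K) (f : Dual X) : linear (pairing f).
Proof. exact: dual_linear. Qed.

Lemma pairing_linearl (X : normedModType K) (x : X) :
  linear (fun f : Dual X => pairing f x).
Proof. by []. Qed.

Lemma dual_ext (X : normedModType K) (f g : Dual X) :
  (forall x, pairing f x = pairing g x) -> f = g.
Proof. by move=> fg; apply/val_inj/funext. Qed.

Lemma mkdual_subproof (X : normedModType K) (f : X -> K^o) (M : K) :
  linear f -> op_bound f M -> f \in dual_pred X.
Proof. by move=> lf fM; apply/asboolP; split => //; exists M. Qed.

Definition mkdual (X : normedModType K) (f : X -> K^o) (M : K)
    (lf : linear f) (fM : op_bound f M) : Dual X :=
  MkDual (mkdual_subproof lf fM).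

Lemma dual_norm_le (X : normedModType K) (f : Dual X) (M : K) :
  0 <= M -> op_bound (pairing f) M -> `|f| <= M.
Proof. exact: opnorm_le. Qed.

Section Canonical_embedding.
Variable X : normedModType K.

Lemma bidual_emb_bound (x : X) : op_bound (fun f : Dual X => pairing f x) `|x|.
Proof. by move=> f; rewrite mulrC pairing_norm. Qed.

Definition bidual_emb (x : X) : Dual (Dual X) :=
  mkdual (@pairing_linearl X x) (bidual_emb_bound x).

Lemma bidual_embE x f : pairing (bidual_emb x) f = pairing f x. Proof. by []. Qed.

End Canonical_embedding.

(* [canon_image X q p] is the canonical image of $X^{(q)}$ in $X^{(p)}$; it is
   meant for $p \ge q$ with $p - q$ even, and empty otherwise. *)
Fixpoint canon_image (X : normedModType K) (q p : nat) {struct p} :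
    set (ndual X p) :=
  if p == q then setT else
  match p return set (ndual X p) with
  | p'.+2 => @bidual_emb (ndual X p') @` @canon_image X q p'
  | _ => set0
  end.
Arguments canon_image : clear implicits.

Section Bounded_linear.

Record bounded_linear (X Y : normedModType K) := BoundedLinear {
  bl_fun :> {linear X -> Y} ;
  bl_bounded : exists M, op_bound bl_fun M }.

Variables (X Y : normedModType K) (T : bounded_linear X Y).

Lemma adjoint_fun_subproof (f : Dual Y) :
  (fun x => pairing f (T x)) \in dual_pred X.
Proof.
apply/asboolP; split => [a u v|]; first by rewrite linearP pairing_linear.
have [M TM] := bl_bounded T; exists (`|f| * M) => x.
by rewrite (le_trans (pairing_norm _ _))// -mulrA ler_wpM2l.
Qed.

Definition adjoint_fun (f : Dual Y) : Dual X := MkDual (adjoint_fun_subproof f).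

Lemma adjoint_fun_linear : linear adjoint_fun.
Proof. by move=> a f g; apply: dual_ext. Qed.

HB.instance Definition _ :=
  GRing.isLinear.Build K (Dual Y) (Dual X) _ adjoint_fun adjoint_fun_linear.

Lemma adjoint_bounded : exists M, op_bound adjoint_fun M.
Proof.
have [M TM] := bl_bounded T; exists `|M| => f.
apply: dual_norm_le => [|x]; first by rewrite mulr_ge0.
 rewrite (le_trans (pairing_norm f (T x)))// (mulrC `|M|) -mulrA.
rewrite ler_wpM2l// (le_trans (TM x))//.
have Mx : 0 <= M * `|x| by exact: le_trans (TM x).
by rewrite -(ger0_norm Mx) normrM normr_id.
Qed.

Definition adjoint : bounded_linear (Dual Y) (Dual X) :=
  BoundedLinear adjoint_bounded.

Lemma adjointE f x : pairing (adjoint f) x = pairing f (T x). Proof. by []. Qed.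

End Bounded_linear.

(* The $r$-th adjoint of $T : X \to Y$ maps $X^{(r)}$ to $Y^{(r)}$ if $r$ is
   even and $Y^{(r)}$ to $X^{(r)}$ if $r$ is odd. *)
Definition arrow (b : bool) (X Y : normedModType K) : Type :=
  if b then bounded_linear Y X else bounded_linear X Y.

Definition adjoint_arrow (b : bool) (X Y : normedModType K) :
    arrow b X Y -> arrow (~~ b) (Dual X) (Dual Y) :=
  match b return arrow b X Y -> arrow (~~ b) (Dual X) (Dual Y) with
  | true => fun T => adjoint T
  | false => fun T => adjoint T
  end.

Fixpoint nadjoint (X Y : normedModType K) (T : bounded_linear X Y) (r : nat) :
    arrow (odd r) (ndual X r) (ndual Y r) :=
  match r return arrow (odd r) (ndual X r) (ndual Y r) with
  | 0%N => T
  | r'.+1 => adjoint_arrow (nadjoint T r')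
  end.

Definition arrow_rel (b : bool) (X Y : normedModType K) :
    arrow b X Y -> X -> Y -> Prop :=
  match b return arrow b X Y -> X -> Y -> Prop with
  | true => fun T x y => T y = x
  | false => fun T x y => T x = y
  end.

Section Linear_span.
Variables (X : normedModType K) (P : set X).

Definition span_pred : pred X := fun x =>
  `[< exists t : seq (K * X), (forall v, v \in t -> P v.2) /\
        x = \sum_(v <- t) v.1 *: v.2 >].

Record span := MkSpan { span_val : X ; span_valP : span_val \in span_pred }.

HB.instance Definition _ := [isSub for span_val].
HB.instance Definition _ := [Choice of span by <:].

Lemma span_submod_closed : submod_closed span_pred.
Proof.
split; first by apply/asboolP; exists [::]; rewrite big_nil.
move=> a u v /asboolP[t [tP ->]] /asboolP[t' [t'P ->]]; apply/asboolP.
exists ([seq (a * w.1, w.2) | w <- t] ++ t'); split.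
  by move=> w; rewrite mem_cat => /orP[/mapP[z /tP ? ->]|/t'P].
rewrite big_cat big_map scaler_sumr; congr (_ + _).
by apply: eq_bigr => w _; rewrite scalerA.
Qed.

HB.instance Definition _ :=
  GRing.isSubmodClosed.Build K X span_pred span_submod_closed.
HB.instance Definition _ := [SubChoice_isSubLmodule of span by <:].

Definition span_norm (x : span) : K := `|span_val x|.

Lemma span_normD x y : span_norm (x + y) <= span_norm x + span_norm y.
Proof. exact: ler_normD. Qed.

Lemma span_normZ (a : K) x : span_norm (a *: x) = `|a| * span_norm x.
Proof. exact: normrZ. Qed.

Lemma span_norm_eq0 x : span_norm x = 0 -> x = 0.
Proof. by move/normr0_eq0 => x0; apply/val_inj. Qed.

HB.instance Definition _ :=
  Lmodule_isNormed.Build K span span_normD span_normZ span_norm_eq0.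

Definition Span : normedModType K := span.

Definition span_incl_fun (x : Span) : X := span_val x.

Lemma span_incl_linear : linear span_incl_fun. Proof. by []. Qed.

HB.instance Definition _ :=
  GRing.isLinear.Build K Span X _ span_incl_fun span_incl_linear.

Lemma span_incl_bounded : exists M, op_bound span_incl_fun M.
Proof. by exists 1 => x; rewrite mul1r. Qed.

Definition span_incl : bounded_linear Span X := BoundedLinear span_incl_bounded.

End Linear_span.

Record bounded_bilinear (X Y Z : normedModType K) := BoundedBilinear {
  bb_fun :> {bilinear X -> Y -> Z} ;
  bb_bounded : exists M, forall x y, `|bb_fun x y| <= M * `|x| * `|y| }.

Lemma bb_bounded_ge0 (X Y Z : normedModType K) (m : bounded_bilinear X Y Z) :
  exists M, 0 <= M /\ forall x y, `|m x y| <= M * `|x| * `|y|.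
Proof.
have [M mM] := bb_bounded m; exists `|M|; split => // x y.
rewrite (le_trans (mM x y))//.
have Mx : 0 <= M * `|x| * `|y| by exact: le_trans (mM x y).
by rewrite -(ger0_norm Mx) !normrM !normr_id.
Qed.

Section Bilinear_zero.
Variables X Y Z : normedModType K.

Definition bb_zero_fun (_ : X) (_ : Y) : Z := 0.

Lemma bb_zero_bilinear :
  bilinear_for (GRing.Scale.Law.clone _ _ *:%R _)
    (GRing.Scale.Law.clone _ _ *:%R _) bb_zero_fun.
Proof. by split=> u a x y; rewrite /bb_zero_fun /= scaler0 addr0. Qed.

HB.instance Definition _ := bilinear_isBilinear.Build K X Y Z _ _
  bb_zero_fun bb_zero_bilinear.

Lemma bb_zero_bounded :
  exists M, forall x y, `|bb_zero_fun x y| <= M * `|x| * `|y|.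
Proof. by exists 0 => x y; rewrite normr0 !mul0r. Qed.

Definition bb_zero : bounded_bilinear X Y Z := BoundedBilinear bb_zero_bounded.

End Bilinear_zero.

Section Bilinear_adjoint.
Variables (X Y Z : normedModType K) (m : bounded_bilinear X Y Z).

Lemma bb_adj_subproof (f : Dual Z) (x : X) :
  (fun y => pairing f (m x y)) \in dual_pred Y.
Proof.
have [M mM] := bb_bounded m; apply: (@mkdual_subproof _ _ (`|f| * (M * `|x|))).
  by move=> a u v; rewrite linearPr pairing_linear.
by move=> y; rewrite (le_trans (pairing_norm _ _))// -mulrA ler_wpM2l.
Qed.

Definition bb_adj_fun (f : Dual Z) (x : X) : Dual Y :=
  MkDual (bb_adj_subproof f x).

Lemma bb_adj_bilinear :
  bilinear_for (GRing.Scale.Law.clone _ _ *:%R _)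
    (GRing.Scale.Law.clone _ _ *:%R _) bb_adj_fun.
Proof.
split=> [x|f] a u v; apply: dual_ext => y //.
change (pairing f (m (a *: u + v) y) =
  a *: pairing f (m u y) + pairing f (m v y)).
by rewrite linearPl pairing_linear.
Qed.

HB.instance Definition _ := bilinear_isBilinear.Build K (Dual Z) X (Dual Y) _ _
  bb_adj_fun bb_adj_bilinear.

Lemma bb_adj_bounded :
  exists M, forall f x, `|bb_adj_fun f x| <= M * `|f| * `|x|.
Proof.
have [M [M0 mM]] := bb_bounded_ge0 m; exists M => f x.
apply: dual_norm_le => [|y]; first by rewrite !mulr_ge0.
rewrite (le_trans (pairing_norm f (m x y)))// (mulrC M) -!mulrA ler_wpM2l//.
by rewrite mulrA.
Qed.

(* [bb_adj m] is $m^* : Z^* \times X \to Y^*$. *)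
Definition bb_adj : bounded_bilinear (Dual Z) X (Dual Y) :=
  BoundedBilinear bb_adj_bounded.

Lemma bb_adjE f x y : pairing (bb_adj f x) y = pairing f (m x y).
Proof. by []. Qed.

End Bilinear_adjoint.

(* The iterated extensions $m^{***}$ at the even levels; the value at odd
   levels is junk. *)
Fixpoint arens (X Y Z : normedModType K) (m : bounded_bilinear X Y Z)
    (n : nat) : bounded_bilinear (ndual X n) (ndual Y n) (ndual Z n) :=
  match n
  return bounded_bilinear (ndual X n) (ndual Y n) (ndual Z n) with
  | 0%N => m
  | 1%N => bb_zero _ _ _
  | n'.+2 => bb_adj (bb_adj (bb_adj (arens m n')))
  end.

(* The topology $\sigma(X^*, X)$. *)
Definition weak_star (X : normedModType K) : Type :=
  initial_topology (fun f : Dual X => (pairing f : {ptws X -> K^o})).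

HB.instance Definition _ (X : normedModType K) :=
  Topological.on (weak_star X).

End Duality.
Arguments canon_image {R s} X q p _.

Record banachAlgebra (R : realType) (s : scalars) := BanachAlgebra {
  ba_car :> completeNormedModType (scalarField R s) ;
  ba_mul : bounded_bilinear ba_car ba_car ba_car ;
  ba_mulA : forall x y z, ba_mul x (ba_mul y z) = ba_mul (ba_mul x y) z ;
  ba_normM : forall x y, `|ba_mul x y| <= `|x| * `|y| }.

Record banachBimodule (R : realType) (s : scalars) (A : banachAlgebra R s) :=
  BanachBimodule {
  bm_car :> completeNormedModType (scalarField R s) ;
  bm_l : bounded_bilinear A bm_car bm_car ;
  bm_r : bounded_bilinear bm_car A bm_car ;
  bm_lA : forall a a' b, bm_l a (bm_l a' b) = bm_l (ba_mul A a a') b ;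
  bm_rA : forall b a a', bm_r (bm_r b a) a' = bm_r b (ba_mul A a a') ;
  bm_lrA : forall a b a', bm_l a (bm_r b a') = bm_r (bm_l a b) a' }.

Section Factors.
Context {R : realType} {s : scalars}.
Variable A : banachAlgebra R s.

Definition arens_products (p q : nat) : set (ndual A p) :=
  [set z | exists a b, canon_image A q p b /\ z = arens (ba_mul A) p a b].
Arguments arens_products : clear implicits.

(* The set of products $a^{(p)} a^{(q)}$ in $A^{(p)}$ for $q \le p$, $q$ even.
   If $p$ is odd, $a^{(q)}$ is viewed in $A^{(p-1)}$, which acts on the right of
   its dual $A^{(p)}$ by $\langle a' a, x\rangle = \langle a', a x\rangle$. *)
Definition products (p q : nat) : set (ndual A p) :=
  match p return set (ndual A p) with
  | 0%N => arens_products 0 q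
  | p'.+1 =>
    if odd p' then arens_products p'.+1 q
    else [set z | exists (a : Dual (ndual A p')) (b : ndual A p'),
            canon_image A q p' b /\ z = bb_adj (arens (ba_mul A) p') a b]
  end.

Definition factor_space (n r : nat) : normedModType (scalarField R s) :=
  Span (@products (n - r) (if odd r then r.-1 else r)).

(* $U_{n,r}$ as an abstract $r$-th dual space. *)
Definition U (n r : nat) : normedModType (scalarField R s) :=
  ndual (factor_space n r) r.

Lemma half_subnKC (n r : nat) : (r <= n./2)%N -> (r + (n - r) = n)%N.
Proof. by move=> hr; rewrite subnKC// (leq_trans hr)// -divn2 leq_div. Qed.

(* $U_{n,r}$ regarded inside $A^{(n)} = (A^{(n-r)})^{(r)}$ through the $r$-th
   adjoint of the inclusion $i$ of the factor space in $A^{(n-r)}$: if $r$ is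
   even, [u] is sent to $i^{(r)}(u)$; if $r$ is odd, $i^{(r)}$ goes from
   $A^{(n)}$ onto $U_{n,r}$, and [u] is sent to a linearly chosen preimage
   (extension) of [u]. *)
Record U_embedding (n r : nat) (hr : (r <= n./2)%N) := UEmbedding {
  U_emb :> {linear U n r -> ndual A n} ;
  U_embP : forall u, exists x : ndual (ndual A (n - r)) r,
    U_emb u = ndual_cast (half_subnKC hr) x /\
    arrow_rel (nadjoint (span_incl _) r) u x }.

End Factors.

Section Topological_centre.
Context {R : realType} {s : scalars} {A : banachAlgebra R s}.
Variable B : banachBimodule A.

Definition lact (n : nat) (phi : ndual A n) (b : ndual B n) : ndual B n :=
  arens (bm_l B) n phi b.

Definition wstar_continuous_lact (n : nat) (phi : ndual A n.+1) : Prop :=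
  continuous (fun b : weak_star (ndual B n) => lact phi b : weak_star (ndual B n)).

(* $Z^\ell_{B^{(n+1)}}(U_{n+1,r})$. *)
Definition Zl (n r : nat) (hr : (r <= n.+1./2)%N) (iota : U_embedding A hr) :
    set (U A n.+1 r) :=
  [set phi | wstar_continuous_lact (iota phi)].

(* $b\phi \in B^{(n+2)}$ for $b \in B^{(n)}$ and $\phi \in A^{(n+1)}$. *)
Definition rmul (n : nat) (b : ndual B n) (phi : ndual A n.+1) : ndual B n.+2 :=
  bb_adj (arens (bm_l B) n.+1) (bidual_emb b) phi.

Lemma rmulE (n : nat) (b : ndual B n) (phi : ndual A n.+1)
    (b' : ndual B n.+1) :
  pairing (rmul b phi) b' = pairing (lact phi b') b.
Proof. by []. Qed.

End Topological_centre.

(* Main.v *)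
Require Import Defs.
From mathcomp Require Import all_boot all_order all_algebra sesquilinear.
From mathcomp Require Import all_classical all_reals all_analysis.

(** Put $X = B^{(n-1)}$ and let $T$ be the action of $\phi$ on $X^* = B^{(n)}$,
    so that $\langle b\phi, f\rangle = \langle Tf, b\rangle$. The weak* topology
    is the initial topology of the evaluations at the points of $X$. Hence $T$ is
    weak*-to-weak* continuous exactly when, for each $b$ in $X$, the functional
    $f \mapsto \langle Tf, b\rangle$, which is $b\phi$, is weak* continuous
    ([weak_star_continuousP]).

    The theorem thus amounts to the fact that the weak* continuous linear
    functionals on $X^*$ are the evaluations at points of $X$
    ([weak_star_continuous_functional]). A weak* continuous $G$ is bounded by 1
    on a basic neighbourhood of 0, which is cut out by finitely many points
    $x_i$ of $X$. By homogeneity $G$ vanishes on the subspace annihilating all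
    the $x_i$, and linear algebra then makes $G$ the evaluation at a linear
    combination of the $x_i$ ([functional_of_annihilator]).

    Both steps hold for an arbitrary linear $T$ on $X^*$
    ([weak_star_continuous_linearP]); the theorem is the case of
    $T f = \phi f$, which is linear because the Arens extension is bilinear. *)

Local Open Scope classical_set_scope.

Section Weak_star_functionals.
Import Order.TTheory GRing.Theory Num.Theory numFieldNormedType.Exports.
Local Open Scope ring_scope.
Context {R : realType} {s : scalars}.
Local Notation K := (scalarField R s).
Implicit Type X : normedModType K.

(** Convergence in the product topology is pointwise convergence, and an initial
    topology pulls it back along the embedding of the dual into the functions
    on $X$. *)
Lemma weak_star_cvgP X (F : set_system (weak_star X)) (f : weak_star X) :
  Filter F ->
  F --> f <-> forall x : X, pairing g x @[g --> F] --> (pairing f x : K^o).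
Proof.
move=> FF; split=> [Ff x|Ff].
  have Fw : (pairing g : {ptws X -> K^o}) @[g --> F] -->
      (pairing f : {ptws X -> K^o}).
    exact: (cvg_comp _ _ Ff (@initial_continuous _ _
      (fun g : Dual X => (pairing g : {ptws X -> K^o})) f)).
  by move/(@pointwise_cvgP X K^o _ _ _) : Fw; apply.
have Fw : (pairing g : {ptws X -> K^o}) @[g --> F] -->
    (pairing f : {ptws X -> K^o}).
  by apply/(@pointwise_cvgP X K^o _ _ _) => x; exact: Ff.
move=> V [W [[D oD <-] Df WV]].
by apply: (filterS WV); apply: Fw; exact: open_nbhs_nbhs.
Qed.

Lemma weak_star_continuousP X (T : topologicalType) (h : T -> weak_star X) :
  continuous h <->
  forall x : X, continuous (fun t => pairing (h t) x : K^o).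
Proof.
split=> [ch x t|ch t].
- by have /weak_star_cvgP := ch t; apply.
- by apply/weak_star_cvgP => x; exact: ch.
Qed.

(** The filter generated by the standard basic weak* neighbourhoods of 0.
    Its convergence to 0 turns continuity at 0 into an estimate at finitely many
    points of $X$. *)
Definition weak_star_basis0 X : set_system (Dual X) :=
  [set V | exists (t : seq X) (e : K), 0 < e /\
     forall f : Dual X, (forall x, x \in t -> `|pairing f x| < e) -> V f].

Lemma weak_star_basis0_filter X : Filter (weak_star_basis0 X).
Proof.
split.
- by exists [::], 1; split.
- move=> V W [t [e [e0 tV]]] [t' [e' [e'0 t'W]]].
  exists (t ++ t'), (Num.min e e'); split.
    by rewrite /Num.min; case: ifP.
  have comp : (e >=< e')%O by rewrite real_comparable ?gtr0_real.
  move=> f ft; split.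
    apply: tV => x xt; have := ft x; rewrite mem_cat xt => /(_ isT).
    by rewrite comparable_lt_min// => /andP[].
  apply: t'W => x xt; have := ft x; rewrite mem_cat xt orbT => /(_ isT).
  by rewrite comparable_lt_min// => /andP[].
- by move=> V W VW [t [e [e0 tV]]]; exists t, e; split=> // f /tV /VW.
Qed.

Lemma weak_star_basis0_cvg X : weak_star_basis0 X --> (0 : weak_star X).
Proof.
have FF := weak_star_basis0_filter X.
apply/weak_star_cvgP => x; apply/cvgrPdist_lt => e e0.
exists [:: x], e; split=> // f /(_ x); rewrite mem_head => /(_ isT).
by rewrite distrC [pairing 0 x](_ : _ = 0)// subr0.
Qed.

(** By induction on the number of points. If every functional that
    vanishes at the other points vanishes at the new point $x$, then $x$ can be
    dropped. Otherwise some $f_0$ vanishes at the others but not at $x$; subtracting a multiple of the evaluation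
    at $x$, chosen so as to kill $f_0$, reduces $G$ to the remaining points. *)
Lemma functional_of_annihilator X (G : Dual X -> K^o) (t : seq X) :
  linear G -> (forall f, (forall x, x \in t -> pairing f x = 0) -> G f = 0) ->
  exists c : X, forall f, G f = pairing f c.
Proof.
elim: t G => [|x t IH] G lG tG.
  by exists 0 => f; rewrite tG// -(subrr (0 : X)) -scaleN1r addrC
    pairing_linear scaleN1r addNr.
have [[f0 [f0t f0x]]|] := pselect (exists f0 : Dual X,
    (forall y, y \in t -> pairing f0 y = 0) /\ pairing f0 x != 0); last first.
  move=> x_redundant; apply: IH => // f ft; apply: tG => y.
  rewrite inE => /predU1P[->|/ft//]; apply/eqP.
  by apply: contrapT => /negP fx; apply: x_redundant; exists f.
pose G1 (f : Dual X) : K^o := G f - pairing f x / pairing f0 x * G f0.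
have [||c Gc] := IH G1.
- move=> a f g; rewrite /G1 lG.
  rewrite (_ : pairing (a *: f + g) x = a * pairing f x + pairing g x)//.
  by rewrite 2!mulrDl opprD addrACA scalerBr -!mulrA.
- move=> f ft.
  (* The projection of f, along f0, onto the functionals that vanish at x. *)
  pose h := (- (pairing f x / pairing f0 x)) *: f0 + f.
  have hE y : pairing h y =
      - (pairing f x / pairing f0 x) * pairing f0 y + pairing f y by [].
  have : G h = 0.
    apply: tG => y; rewrite inE hE => /predU1P[->|yt].
      by rewrite mulNr divfK// addNr.
    by rewrite (f0t y yt) (ft y yt) mulr0 addr0.
  by rewrite lG scaleNr addrC.
- exists ((G f0 / pairing f0 x) *: x + c) => f.
  rewrite pairing_linear -Gc /G1.
  rewrite [_ *: _](_ : _ = G f0 / pairing f0 x * pairing f x)//.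
  rewrite (mulrC _ (G f0)) mulrA (mulrAC (G f0)).
  by rewrite [RHS]addrC subrK.
Qed.

(** Continuity at 0 gives finitely many points of $X$ such that $|G| < 1$ on
    the functionals that are small there. A functional vanishing at these points
    has all its multiples in that set, so $G$ kills it. *)
Lemma weak_star_continuous_functional X (G : Dual X -> K^o) :
  linear G -> continuous (G : weak_star X -> K^o) ->
  exists c : X, forall f, G f = pairing f c.
Proof.
move=> lG cG.
have G0 : G 0 = 0.
  by rewrite -(subrr (0 : Dual X)) -scaleN1r addrC lG scaleN1r addNr.
have GZ a f : G (a *: f) = a * G f.
  by rewrite -[a *: f]addr0 lG G0 addr0.
have FF := weak_star_basis0_filter X.
have : G f @[f --> weak_star_basis0 X] --> (G 0 : K^o).
  exact: (cvg_comp _ _ (weak_star_basis0_cvg X) (cG 0)).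
move/cvgrPdist_lt => /(_ 1 ltr01)[t [e [e0 te]]].
apply: (@functional_of_annihilator X G t lG) => f ft.
apply: contrapT => /eqP Gf0.
(* This multiple of f is still zero on t, but G takes the value 1 at it. *)
have := te ((G f)^-1 *: f).
rewrite /= G0 sub0r normrN GZ mulVf// normr1 ltxx.
suff H : forall x, x \in t -> `|pairing ((G f)^-1 *: f) x| < e by move/(_ H).
move=> x xt; rewrite (_ : pairing _ x = (G f)^-1 * pairing f x)//.
by rewrite ft// mulr0 normr0.
Qed.

(** The condition on the right says that the algebraic transpose of $T$ maps the
    evaluations at points of $X$ to such evaluations. *)
Lemma weak_star_continuous_linearP X (T : Dual X -> Dual X) :
  linear T ->
  continuous (T : weak_star X -> weak_star X) <->
  forall x : X, exists c : X, forall f, pairing (T f) x = pairing f c.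
Proof.
move=> lT; split=> [/weak_star_continuousP cT x|Tc].
  apply: (@weak_star_continuous_functional X (fun f => pairing (T f) x)).
    by move=> a f g; rewrite lT.
  exact: cT.
apply/weak_star_continuousP => x.
have [c Txc] := Tc x.
rewrite (_ : (fun f => _) = (fun f : weak_star X => pairing f c : K^o)).
  (* The evaluation at c is continuous because the identity is. *)
  have /weak_star_continuousP := fun f : weak_star X => @cvg_id _ (nbhs f).
  exact.
exact/funext.
Qed.

End Weak_star_functionals.

Theorem theorem2p1 (R : realType) (s : scalars) (A : banachAlgebra R s)
    (B : banachBimodule A) (n r : nat) (n_even : ~~ odd n)
    (hr : (r <= n.+2./2)%N) (iota : U_embedding A hr) (phi : U A n.+2 r) :
  Zl B iota phi <->
  forall b : ndual B n.+1, exists c : ndual B n.+1,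
    rmul b (iota phi) = bidual_emb c.
Proof.
have actP := @weak_star_continuous_linearP R s (ndual B n.+1) (lact (iota phi))
  (fun a f g => linearPr (arens (bm_l B) n.+2) (iota phi) a f g).
split=> [/actP bc b|bc].
  have [c bphi_c] := bc b; exists c; apply: dual_ext => b'.
  exact: bphi_c.
apply/actP => b; have [c bphi_c] := bc b; exists c => b'.
exact: (congr1 (fun F => pairing F b') bphi_c).
Qed.
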